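(* Let $\mathfrak{o}$ be the ring of integers in a local field $F$ of characteristic zero with residue field of characteristic $p>0$, let $G$ be a finite group with commutator subgroup $G'$, and let $\Lambda := \mathfrak{o}[G]$. Put $\mathrm{Tr}_{G'} := \sum_{g'\in G'}g'$. With $\chi_i$, $\mathfrak{o}_i'$, $\mathfrak{A}_i$ ($1\le i\le k$) as defined in the context, we have the containment $$\mathfrak{o}[G]\cdot\mathrm{Tr}_{G'}\oplus\bigoplus_{\substack{1\le i\le k\\ \chi_i(1)\ne1}}\frac{|G|}{\chi_i(1)}\mathfrak{A}_i^{-1}\mathfrak{D}^{-1}(\mathfrak{o}_i'/\mathfrak{o})\subset\mathcal{H}(\Lambda).$$
   Context: $\zeta(\cdot)$ denotes the centre of a ring. Let $\overline{F}$ be an algebraic closure of $F$ and let $\chi_1,\dots,\chi_k$ be representatives of the irreducible $\overline{F}$-valued characters of $G$ modulo the action of $\mathrm{Gal}(\overline{F}/F)$. Let $F_i := F(\chi_i(g)\mid g\in G)$ and let $\mathfrak{o}_i'$ be its ring of integers. There is a natural identification $\zeta(F[G])\simeq\bigoplus_{i=1}^kF_i$, where $\alpha_i\in F_i$ corresponds to $\sum_{\sigma\in\mathrm{Gal}(F_i/F)}\alpha_i^\sigma\frac{\chi_i(1)}{|G|}\sum_{g\in G}\chi_i^\sigma(g^{-1})g$. Let $\mathfrak{A}_i := \langle\chi_i(g)\mid g\in G\rangle_{\mathfrak{o}_i'}$ be the ideal of $\mathfrak{o}_i'$ generated by the values of $\chi_i$, $\mathfrak{A}_i^{-1}$ its inverse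 fractional ideal, and $\mathfrak{D}^{-1}(\mathfrak{o}_i'/\mathfrak{o}) := \{x\in F_i\mid\mathrm{Tr}_{F_i/F}(x\mathfrak{o}_i')\subset\mathfrak{o}\}$ the inverse different. Definition of $\mathcal{H}(\Lambda)$: let $A=F[G]$ with central primitive idempotents $e_1,\dots,e_k$ (with $e_i$ corresponding to $\chi_i$), $A_i = Ae_i \simeq M_{n_i\times n_i}(D_i)$ with $D_i$ a skewfield with centre $F_i$ and $[D_i:F_i]=s_i^2$. For $H\in M_{b\times b}(\Lambda)$ put $H_i = He_i$, $m_i = n_i s_i b$, let $f_i(X)=\sum_{j=0}^{m_i}\alpha_{ij}X^j$ be the reduced characteristic polynomial of $H_i$ (over $F_i$), and set $H_i^{\ast} := (-1)^{m_i+1}\sum_{j=1}^{m_i}\alpha_{ij}H_i^{j-1}$ (with $H_i^0$ the identity of $M_{b\times b}(A_i)$), $H^{\ast} := \sum_{i} H_i^{\ast}$. Put $$\mathcal{H}(\Lambda) := \{x\in\zeta(\Lambda)\mid xH^{\ast}\in M_{b\times b}(\Lambda)\ \text{for all } H\in M_{b\times b}(\Lambda) \text{ and all } b\in\mathbb{N}\}.$$ *)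

(* Defs.v *)
From HB Require Import structures.
From mathcomp Require Import all_boot all_order all_algebra all_fingroup.
From mathcomp Require Import all_solvable all_field all_character.
From mathcomp Require classical_sets.

Set Implicit Arguments.
Unset Strict Implicit.
Unset Printing Implicit Defensive.

Import Order.TTheory GRing.Theory Num.Theory.
Local Open Scope ring_scope.

(* The unique preimage of y when f is injective and y is in its range; the
   junk value 0 when y is not in the range. *)
Definition descend (A : zmodType) (B : Type) (f : A -> B) (y : B) : A :=
  classical_sets.xget 0 (fun x => f x = y).

Section LocalField.
Variables (F : fieldType) (v : F -> int).

(* v is only meaningful on nonzero elements; v 0 stands for +oo. *)
Definition val_ge (m : int) : {pred F} := [pred x | (x == 0) || (m <= v x)].
Definition valring : {pred F} := val_ge 0.
Definition valmax : {pred F} := val_ge 1.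

(* Complete discretely valued field, with normalized valuation v and finite
   residue field valring / valmax. *)
Record local_field : Prop := LocalField {
  valM : forall x y, x != 0 -> y != 0 -> v (x * y) = v x + v y;
  valD : forall x y, x != 0 -> y != 0 -> x + y != 0 ->
    Num.min (v x) (v y) <= v (x + y);
  val_unif : exists2 x, x != 0 & v x = 1;
  val_complete : forall u : nat -> F,
    (forall m : int, exists N : nat, forall i j : nat,
       (N <= i)%N -> (N <= j)%N -> u i - u j \in val_ge m) ->
    exists l : F, forall m : int, exists N : nat, forall i : nat,
       (N <= i)%N -> u i - l \in val_ge m;
  residue_finite : exists s : seq F, forall x, x \in valring ->
    exists2 y, y \in s & x - y \in valmax }.

Definition residue_char (p : nat) : Prop := prime p /\ p%:R \in valmax.

End LocalField.

(* The group ring R[gT]: functions with the convolution product. *)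
Definition galg (R : nzRingType) (gT : finGroupType) : Type := {ffun gT -> R}.

Section GroupRing.
Variables (R : nzRingType) (gT : finGroupType).

HB.instance Definition _ := GRing.Zmodule.copy (galg R gT) {ffun gT -> R}.

Definition galg_one : galg R gT := [ffun g => (g == 1%g)%:R].
Definition galg_mul (a b : galg R gT) : galg R gT :=
  [ffun g => \sum_h a h * b (h^-1 * g)%g].

Fact galg_mulA : associative galg_mul.
Proof.
move=> a b c; apply/ffunP => g; rewrite !ffunE.
under eq_bigr => h _ do rewrite ffunE mulr_sumr.
under [RHS]eq_bigr => h _ do rewrite ffunE mulr_suml.
rewrite [RHS]exchange_big /=; apply: eq_bigr => h _.
rewrite [RHS](reindex (fun x => (h * x)%g)) /=; last first.
  by exists (fun x => (h^-1 * x)%g) => x _; rewrite ?mulKg ?mulKVg.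
by apply: eq_bigr => x _; rewrite mulKg invMg !mulgA mulrA.
Qed.

Fact galg_mul1 : left_id galg_one galg_mul.
Proof.
move=> a; apply/ffunP => g; rewrite ffunE (bigD1 1%g) //= ffunE eqxx mul1r.
rewrite invg1 mul1g big1 ?addr0 // => h /negPf h1.
by rewrite ffunE h1 mul0r.
Qed.

Fact galg_mul1r : right_id galg_one galg_mul.
Proof.
move=> a; apply/ffunP => g; rewrite ffunE (bigD1 g) //= ffunE mulVg eqxx mulr1.
rewrite big1 ?addr0 // => h hg.
by rewrite ffunE -eq_mulVg1 (negPf hg) mulr0.
Qed.

Fact galg_mulDl : left_distributive galg_mul +%R.
Proof.
move=> a b c; apply/ffunP => g; rewrite !ffunE -big_split /=.
by apply: eq_bigr => h _; rewrite ffunE mulrDl.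
Qed.

Fact galg_mulDr : right_distributive galg_mul +%R.
Proof.
move=> a b c; apply/ffunP => g; rewrite !ffunE -big_split /=.
by apply: eq_bigr => h _; rewrite ffunE mulrDr.
Qed.

Fact galg_oner_neq0 : galg_one != 0.
Proof. by apply/eqP => /ffunP/(_ 1%g)/eqP; rewrite !ffunE eqxx oner_eq0. Qed.

HB.instance Definition _ := GRing.Zmodule_isNzRing.Build (galg R gT)
  galg_mulA galg_mul1 galg_mul1r galg_mulDl galg_mulDr galg_oner_neq0.

Definition trace_der : galg R gT :=
  [ffun g => (g \in ([set: gT]^`(1))%g)%:R].

End GroupRing.

Definition intgalg (F : fieldType) (v : F -> int) {gT : finGroupType} :
    {pred galg F gT} := [pred a : galg F gT | [forall g, a g \in valring v]].

Definition center_int (F : fieldType) (v : F -> int) (gT : finGroupType)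
    (x : galg F gT) : Prop :=
  x \in intgalg v /\ forall y, y \in intgalg v -> x * y = y * x.

(* An irreducible character of gT with values in Fbar, given by a matrix
   representation ic_rep affording it, together with its field of values
   F(chi(g) | g in gT): a finite normal extension ic_field of F embedded in
   Fbar over F by ic_emb, and generated over F by the values ic_val g of the
   character. *)
Record irrchar (F : fieldType) (Fbar : closedFieldType)
    (iota : {rmorphism F -> Fbar}) (gT : finGroupType) : Type := Irrchar {
  ic_deg : nat;
  ic_rep : mx_representation Fbar [set: gT] ic_deg;
  ic_irr : mx_irreducible ic_rep;
  ic_field : splittingFieldType F;
  ic_emb : {rmorphism ic_field -> Fbar};
  ic_embF : forall a : F, ic_emb a%:A = iota a;
  ic_val : gT -> ic_field;
  ic_valE : forall g, ic_emb (ic_val g) = \tr (ic_rep g);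
  ic_gen : <<1 & [seq ic_val g | g <- enum gT]>>%VS = fullv }.

Section Representatives.
Variables (F : fieldType) (Fbar : closedFieldType).
Variables (iota : {rmorphism F -> Fbar}) (gT : finGroupType).

Definition galois_conj (f1 f2 : gT -> Fbar) : Prop :=
  exists sigma : {rmorphism Fbar -> Fbar},
    [/\ bijective sigma, forall a, sigma (iota a) = iota a &
        forall g, f2 g = sigma (f1 g)].

Definition galois_representatives (k : nat)
    (chi : 'I_k -> irrchar iota gT) : Prop :=
  (forall (n : nat) (r : mx_representation Fbar [set: gT] n),
     mx_irreducible r ->
     exists i, galois_conj (fun g => \tr (ic_rep (chi i) g))
                           (fun g => \tr (r g))) /\
  (forall i j, galois_conj (fun g => \tr (ic_rep (chi i) g))
                           (fun g => \tr (ic_rep (chi j) g)) -> i = j).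

End Representatives.

Section Integers.
Variables (F : fieldType) (v : F -> int) (L : splittingFieldType F).

Definition ringint (x : L) : Prop :=
  exists q : {poly F}, [/\ q \is monic, q \is a polyOver (valring v) &
                           root (map_poly (in_alg L) q) x].

Definition field_trace (x : L) : F :=
  descend (in_alg L) (galTrace 1 {:L} x).

Definition inv_different (x : L) : Prop :=
  forall y, ringint y -> field_trace (x * y) \in valring v.

Definition inv_ideal (I : L -> Prop) (x : L) : Prop :=
  forall y, I y -> ringint (x * y).

Definition mul_ideal (I J : L -> Prop) (x : L) : Prop :=
  exists n (a b : 'I_n -> L), [/\ forall j, I (a j), forall j, J (b j) &
                                  x = \sum_j a j * b j].

End Integers.

Section Component.
Variables (F : fieldType) (v : F -> int) (Fbar : closedFieldType).
Variables (iota : {rmorphism F -> Fbar}) (gT : finGroupType).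
Variable chi : irrchar iota gT.
Let L := ic_field chi.

(* The ideal of the ring of integers of L generated by the character values. *)
Definition val_ideal (x : L) : Prop :=
  exists2 c : gT -> L, forall g, ringint v (c g)
                     & x = \sum_g c g * ic_val chi g.

(* The embedding of L into the centre of F[gT]; its coefficients are written
   in L, where they are Galois-invariant, and taken back to F. *)
Definition center_emb (a : L) : galg F gT :=
  [ffun g => descend (in_alg L)
     (\sum_(s in 'Gal({:L} / 1%AS)%g)
        s a * ((ic_deg chi)%:R / #|gT|%:R) * s (ic_val chi g^-1%g))].

Definition idem : galg F gT := center_emb 1.

(* The F-linear extension of the representation to F[gT]. Restricted to
   A = F[gT] idem, with centre L embedded in Fbar by ic_emb, it induces
   the splitting isomorphism Fbar (x)_L A = 'M[Fbar]_(ic_deg chi), so that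
   A = 'M_n(D) with [D : L] = s^2 gives ic_deg chi = n s. *)
Definition rep_ext (a : galg F gT) : 'M[Fbar]_(ic_deg chi) :=
  \sum_g iota (a g) *: ic_rep chi g.

(* The reduced characteristic polynomial: the characteristic polynomial after
   splitting by Fbar, whose coefficients are in the image of L. *)
Definition red_char_poly (b : nat) (H : 'M[galg F gT]_b) : {poly L} :=
  map_poly (descend (ic_emb chi))
    (char_poly (\mxblock_(i < b, j < b) rep_ext (H i j))).

(* The factor idem makes the zeroth power the identity of 'M_b(A). *)
Definition star_component (b : nat) (H : 'M[galg F gT]_b) : 'M[galg F gT]_b :=
  let Hi := map_mx (fun a => a * idem) H in
  let f := red_char_poly Hi in
  let m := (ic_deg chi * b)%N in
  (-1) ^+ m.+1 *:
    \sum_(1 <= j < m.+1) center_emb f`_j *: (idem *: Hi ^+ j.-1).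

Definition char_summand (x : galg F gT) : Prop :=
  exists2 y, mul_ideal (inv_ideal v val_ideal) (@inv_different F v L) y
           & x = center_emb (#|gT|%:R / (ic_deg chi)%:R * y).

End Component.

Section ScriptH.
Variables (F : fieldType) (v : F -> int) (Fbar : closedFieldType).
Variables (iota : {rmorphism F -> Fbar}) (gT : finGroupType) (k : nat).
Variable chi : 'I_k -> irrchar iota gT.

Definition star (b : nat) (H : 'M[galg F gT]_b) : 'M[galg F gT]_b :=
  \sum_i star_component (chi i) H.

Definition scriptH (x : galg F gT) : Prop :=
  center_int v x /\
  forall (b : nat) (H : 'M[galg F gT]_b), H \is a mxOver (intgalg v) ->
    x *: star H \is a mxOver (intgalg v).

Definition der_summand (x : galg F gT) : Prop :=
  exists2 a, a \in intgalg v & x = a * trace_der F gT.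

End ScriptH.

(* Main.v *)
(* Let rho_i be the representation affording chi_i, extended linearly to F[G].
   Schur's lemma and the fact that automorphisms of F_i over F extend to the
   algebraic closure give rho_i (center_emb a) = a for a in F_i, and
   rho_j (center_emb a) = 0 for j <> i; by Maschke's theorem an element of F[G]
   killed by every rho_i is zero, so identities in F[G] may be checked after
   applying the rho_i.

   For x = center_emb (|G| / chi_i(1) * y) only the i-th component of H* matters
   and x H* = +- sum_j center_emb (|G| / chi_i(1) * y alpha_j) H^(j-1). The
   alpha_j are integral, so y alpha_j still lies in A_i^-1 D^-1, and for such an
   element y' the coefficient at g of center_emb (|G| / chi_i(1) * y') is
   Tr (y' chi_i(g^-1)), an element of o.

   Tr_G' is killed by rho_i when chi_i(1) <> 1. When chi_i(1) = 1, the matrix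
   rho_i H has commutative entries and rho_i H* is its adjugate. Hence
   Tr_G' H* = Tr_G' adj(H), where adj(H) is the matrix over the noncommutative
   ring F[G] given by the usual cofactor formula, which is integral. *)
From HB Require Import structures.
Require Import Defs.
From mathcomp Require Import all_boot all_order all_algebra all_fingroup.
From mathcomp Require Import all_solvable all_field all_character.
From mathcomp Require boolp classical_sets.

Set Implicit Arguments.
Unset Strict Implicit.
Unset Printing Implicit Defensive.

Import Order.TTheory GRing.Theory Num.Theory.
Local Open Scope ring_scope.

(** * Extension of automorphisms to the algebraic closure *)

Section Extension.
Variables (L : fieldType) (K : closedFieldType) (e1 e2 : {rmorphism L -> K}).
Hypothesis algK : forall x : K, algebraicOver e1 x.

(* Graphs of ring morphisms from a subring of K containing the image of e1 to
   K that send e1 a to e2 a. *)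
Record partial_hom (E : K -> K -> Prop) : Prop := PartialHom {
  ph_base : forall a, E (e1 a) (e2 a);
  ph_sub : forall a b c d, E a b -> E c d -> E (a - c) (b - d);
  ph_mul : forall a b c d, E a b -> E c d -> E (a * c) (b * d);
  ph_fun : forall b, E 0 b -> b = 0 }.

Lemma eq_partial_hom E E' :
  (forall a b, E a b <-> E' a b) -> partial_hom E -> partial_hom E'.
Proof.
move=> eqE; suff -> : E' = E by [].
apply/boolp.funext=> a; apply/boolp.funext=> b.
by apply/boolp.propext; split=> /eqE.
Qed.

Lemma partial_hom_base :
  partial_hom (fun a b => exists c, a = e1 c /\ b = e2 c).
Proof.
split=> [a | _ _ _ _ [a [-> ->]] [b [-> ->]]
        | _ _ _ _ [a [-> ->]] [b [-> ->]] | b [c]].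
- by exists a.
- by exists (a - b); rewrite !rmorphB.
- by exists (a * b); rewrite !rmorphM.
by case=> /esym/eqP; rewrite fmorph_eq0 => /eqP -> ->; rewrite rmorph0.
Qed.

Section OnePartialHom.
Variables (E : K -> K -> Prop) (homE : partial_hom E).

Lemma ph0 : E 0 0.
Proof. by have := ph_base homE 0; rewrite !rmorph0. Qed.

Lemma ph1 : E 1 1.
Proof. by have := ph_base homE 1; rewrite !rmorph1. Qed.

Lemma phN a b : E a b -> E (- a) (- b).
Proof. by move=> Eab; rewrite -(sub0r a) -(sub0r b); apply: ph_sub ph0 Eab. Qed.

Lemma phD a b c d : E a b -> E c d -> E (a + c) (b + d).
Proof.
by move=> Eab /phN Ecd; rewrite -(opprK c) -(opprK d); apply: ph_sub Eab Ecd.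
Qed.

Lemma phX a b n : E a b -> E (a ^+ n) (b ^+ n).
Proof.
move=> Eab; elim: n => [|n IHn]; first exact: ph1.
by rewrite !exprS; apply: ph_mul Eab IHn.
Qed.

Lemma ph_sum (I : Type) (r : seq I) (P : pred I) (A B : I -> K) :
  (forall i, P i -> E (A i) (B i)) ->
  E (\sum_(i <- r | P i) A i) (\sum_(i <- r | P i) B i).
Proof. by move=> EAB; apply: (big_ind2 E ph0 phD) => i /EAB. Qed.

Lemma ph_inj a b c : E a b -> E a c -> b = c.
Proof.
move=> Eab Eac; apply/eqP; rewrite -subr_eq0; apply/eqP/(ph_fun homE).
by rewrite -(subrr a); apply: ph_sub Eab Eac.
Qed.

(* K is algebraic over the image of e1, so the domain is a subfield. *)
Lemma ph_inv a b : E a b -> exists c, E a^-1 c.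
Proof.
move=> Eab; have [-> | a_neq0] := eqVneq a 0.
  by exists 0; rewrite invr0; exact: ph0.
have [f mon_f fa0] := (integral_algebraic e1 a^-1).1 (algK a^-1).
pose n := (size f).-1.
have Da : a^-1 = - \sum_(i < n) e1 f`_i * a ^+ (n - i.+1).
  have n_gt0 : (0 < n)%N.
    rewrite /n -subn1 subn_gt0 -(size_map_poly e1); apply: root_size_gt1 fa0.
    by rewrite map_poly_eq0 monic_neq0.
  have an0 : a ^+ n.-1 != 0 by rewrite expf_neq0.
  move/rootP: fa0; rewrite horner_coef size_map_poly polySpred ?monic_neq0 //.
  rewrite -/n big_ord_recr /= coef_map /= -lead_coefE (monicP mon_f) rmorph1.
  rewrite mul1r => /eqP; rewrite addrC addr_eq0 => /eqP Dan.
  apply: (mulIf (expf_neq0 n.-1 (invr_neq0 a_neq0))).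
  rewrite -exprS prednK // Dan mulNr mulr_suml; congr (- _).
  apply: eq_bigr => i _.
  rewrite coef_map /= -mulrA; congr (_ * _).
  have lt_i : (i <= n.-1)%N by rewrite -ltnS prednK.
  have -> : (n - i.+1 = n.-1 - i)%N by rewrite -{1}(prednK n_gt0) subSS.
  by rewrite -{2}(subnK lt_i) exprD mulrA -exprMn divff ?expr1n ?mul1r.
exists (- \sum_(i < n) e2 f`_i * b ^+ (n - i.+1)); rewrite Da; apply: phN.
by apply: ph_sum => i _; apply: (ph_mul homE) (ph_base homE _) (phX _ Eab).
Qed.

(** Simple algebraic extension: among the monic polynomials over the domain of [E] with root [x],
    one of least degree is transported to [q0], and [x] is sent to a root [y] of [q0]. *)
Lemma ph_extend x : exists E' : K -> K -> Prop,
  [/\ partial_hom E', forall a b, E a b -> E' a b & exists y, E' x y].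
Proof.
(* [E] is a relation, so a polynomial is transported as a pair related coefficient by
   coefficient. *)
pose EP (p q : {poly K}) := forall i, E p`_i q`_i.
have EPB p q r s : EP p q -> EP r s -> EP (p - r) (q - s).
  by move=> Epq Ers i; rewrite !coefB; apply: (ph_sub homE).
have EPM p q r s : EP p q -> EP r s -> EP (p * r) (q * s).
  move=> Epq Ers i; rewrite !coefM; apply: ph_sum => j _.
  exact: (ph_mul homE).
have EPC a b : E a b -> EP a%:P b%:P.
  by move=> Eab i; rewrite !coefC; case: ifP => // _; apply: ph0.
have EPXn n : EP 'X^n 'X^n.
  by move=> i; rewrite !coefXn; case: eqP => _; [apply: ph1 | apply: ph0].
pose good n := boolp.asbool (exists p q,
  [/\ EP p q, p \is monic, root p x & size p = n]).
have exn : exists n, good n.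
  have [f mon_f fx0] := (integral_algebraic e1 x).1 (algK x).
  exists (size f); apply/boolp.asboolP.
  exists (map_poly e1 f), (map_poly e2 f); split=> //.
  - by move=> i; rewrite !coef_map; apply: (ph_base homE).
  - exact: monic_map.
  by rewrite size_map_poly.
case: (ex_minnP exn) => n /boolp.asboolP [p0 [q0 []]].
move=> Epq0 mon_p0 p0x sz_p0 min_n.
(* This makes [size q0] at least [size p0], hence different from 1, so that [q0] has a root. *)
have mon_q0 : q0`_(size p0).-1 = 1.
  apply: (ph_inj (Epq0 _)); rewrite -lead_coefE (monicP mon_p0); exact: ph1.
have size_q0 : size q0 != 1%N.
  have p0_gt1 : (1 < size p0)%N by apply: root_size_gt1 p0x; rewrite monic_neq0.
  apply: contraTneq p0_gt1 => sz_q0; rewrite -leqNgt.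
  have: (size p0).-1 \in [pred j | q0`_j != 0] by rewrite inE mon_q0 oner_eq0.
  rewrite inE; apply: contraR; rewrite -ltnNge => lt1.
  by rewrite nth_default // sz_q0; case: (size p0) lt1 => [|[]].
have [y q0y] := closed_rootP q0 size_q0.
(* Well-definedness of [p.[x] |-> q.[y]]: division of [p] by [p0] is run in parallel with division
   of [q] by [q0], by induction on the size of [p]. *)
have zero_y p q : EP p q -> p.[x] = 0 -> q.[y] = 0.
  have [m] := ubnP (size p); elim: m p q => // m IHm p q le_m Epq px0.
  have [p_eq0 | p_neq0] := eqVneq p 0.
    suff -> : q = 0 by rewrite horner0.
    apply/polyP=> i; rewrite coef0; apply: (ph_fun homE).
    by have := Epq i; rewrite p_eq0 coef0.
  pose a := lead_coef p; pose b := q`_(size p).-1.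
  have Eab : E a b by apply: Epq.
  have a_neq0 : a != 0 by rewrite lead_coef_eq0.
  (* The inverse of the leading coefficient is again in the domain, so [p] can be made monic and
     competes with [p0] for minimality. *)
  have le_n_p : (n <= size p)%N.
    have [c Eac] := ph_inv Eab; apply: min_n; apply/boolp.asboolP.
    exists (a^-1%:P * p), (c%:P * q); split.
    - by apply: EPM => //; apply: EPC.
    - by rewrite monicE lead_coefM lead_coefC mulVf.
    - by rewrite rootM orbC; apply/orP; left; apply/rootP.
    by rewrite mul_polyC size_scale // invr_eq0.
  pose k := (size p - n)%N.
  have n_gt0 : (0 < n)%N by rewrite -sz_p0 size_poly_gt0 monic_neq0.
  have := IHm (p - a%:P * 'X^k * p0) (q - b%:P * 'X^k * q0).
  rewrite !hornerE (rootP p0x) (rootP q0y) !mulr0 px0 !subr0.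
  apply=> //; last first.
    by apply: (EPB) => //; do 2!apply: (EPM) => //; apply: EPC.
  have size_r : size (a%:P * 'X^k * p0) = size p.
    rewrite -mulrA mul_polyC size_scale // mulrC.
    rewrite size_Mmonic ?monicXn ?monic_neq0 //.
    by rewrite size_polyXn sz_p0 addnS /= subnKC.
  rewrite -ltnS; apply: leq_trans le_m; rewrite ltnS.
  have lead_r : lead_coef (a%:P * 'X^k * p0) = a.
    by rewrite !lead_coefM lead_coefC lead_coefXn (monicP mon_p0) !mulr1.
  have [-> | r_neq0] := eqVneq (p - a%:P * 'X^k * p0) 0.
    by rewrite size_poly0 size_poly_gt0.
  rewrite -(prednK (_ : 0 < size p)%N) ?size_poly_gt0 // ltnS.
  apply/leq_sizeP => j; rewrite leq_eqVlt => /predU1P[<-|lt_j].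
    by rewrite coefB -{2}size_r -!lead_coefE lead_r subrr.
  rewrite nth_default // (leq_trans (size_polyD _ _)) // size_polyN size_r maxnn.
  by rewrite -(prednK (_ : 0 < size p)%N) ?size_poly_gt0.
exists (fun a b => exists p q, [/\ EP p q, a = p.[x] & b = q.[y]]); split.
- split.
  + move=> a; exists (e1 a)%:P, (e2 a)%:P; rewrite !hornerC; split=> //.
    by apply/EPC/(ph_base homE).
  + move=> _ _ _ _ [p [q [Epq -> ->]]] [r [s [Ers -> ->]]].
    by exists (p - r), (q - s); rewrite !hornerE; split=> //; apply: EPB.
  + move=> _ _ _ _ [p [q [Epq -> ->]]] [r [s [Ers -> ->]]].
    by exists (p * r), (q * s); rewrite !hornerE; split=> //; apply: EPM.
  by move=> b [p [q [Epq /esym px0 ->]]]; apply: zero_y px0.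
- move=> a b Eab; exists a%:P, b%:P; rewrite !hornerC; split=> //.
  exact: EPC.
exists y, 'X, 'X; rewrite !hornerX; split=> //.
by rewrite -['X]expr1; apply: EPXn.
Qed.

End OnePartialHom.

(** Zorn's lemma for graphs ordered by inclusion: by [ph_extend] a maximal graph is defined
    everywhere. *)
Lemma partial_hom_total : exists E, partial_hom E /\ forall x, exists y, E x y.
Proof.
pose base a b := exists c, a = e1 c /\ b = e2 c.
(* Adding the base relation handles the empty chain of Zorn's lemma. *)
pose ext (X : classical_sets.set (K * K)) a b := base a b \/ X (a, b).
have [C totC | A [homA maxA]] := @classical_sets.Zorn_bigcup (K * K)
    (fun X => partial_hom (ext X)).
  move=> chainC; set U := (X in ext X).
  (* Two pairs of the union already lie in one member of the chain, or in the base relation, where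
     closure is known. *)
  have ext2 a b c d : ext U a b -> ext U c d ->
    exists X, [/\ partial_hom (ext X), ext X a b, ext X c d &
                  forall p q, ext X p q -> ext U p q].
    have sub X : C X -> forall p q, ext X p q -> ext U p q.
      by move=> CX p q [?|Xpq]; [left | right; exists X].
    move=> [ab|[X CX Xab]] [cd|[Y CY Ycd]].
    - exists (fun _ => False); split; try by [left | move=> p q [?|[]]; left].
      apply: eq_partial_hom partial_hom_base => p q.
      by split=> [|[?|[]]//]; left.
    - by exists Y; split; [apply: totC | left | right | apply: sub].
    - by exists X; split; [apply: totC | right | left | apply: sub].
    case: (chainC X Y CX CY) => [sXY | sYX].
      by exists Y; split; [apply: totC | right; apply: sXY | right | apply: sub].
    by exists X; split; [apply: totC | right | right; apply: sYX | apply: sub].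
  split=> [a | a b c d Eab Ecd | a b c d Eab Ecd | b E0b].
  - by left; exists a.
  - have [X [homX Xab Xcd]] := ext2 _ _ _ _ Eab Ecd.
    by apply; apply: (ph_sub homX).
  - have [X [homX Xab Xcd]] := ext2 _ _ _ _ Eab Ecd.
    by apply; apply: (ph_mul homX).
  have [X [homX X0b _ _]] := ext2 _ _ _ _ E0b E0b.
  exact: (ph_fun homX).
exists (ext A); split=> // x.
have [E' [homE' sAE' [y E'xy]]] := ph_extend homA x.
exists y; apply: boolp.contrapT => nAxy.
apply: (maxA (fun p => E' p.1 p.2)).
  split=> [[a b] Aab | sE'A]; first by apply: sAE'; right.
  by apply: nAxy; right; apply: sE'A.
apply: eq_partial_hom homE' => a b; split=> [|[Bab|//]]; first by right.
by apply: sAE'; left.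
Qed.

(** With [e2] the composite of [e1] and an automorphism of [L], this lifts the automorphism to
    [K]. *)
Lemma extend_rmorphism :
  exists sigma : {rmorphism K -> K}, forall a, sigma (e1 a) = e2 a.
Proof.
have [E [homE /boolp.choice [f Ef]]] := partial_hom_total.
have fB : zmod_morphism f.
  by move=> a b; apply: (ph_inj homE (Ef _)); apply: (ph_sub homE).
have fM : monoid_morphism f.
  split=> [|a b]; apply: (ph_inj homE (Ef _)); first exact: ph1.
  exact: (ph_mul homE).
pose fA := GRing.isZmodMorphism.Build _ _ f fB.
pose fR := GRing.isMonoidMorphism.Build _ _ f fM.
pose sigma : {rmorphism K -> K} := HB.pack f fA fR.
exists sigma => a; exact: (ph_inj homE (Ef _) (ph_base homE a)).
Qed.

End Extension.

(** [sigma] maps the finite set of roots of a polynomial over [F] injectively into itself, hence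
    onto itself, and each element of [K] is such a root. *)
Lemma algebraic_endo_bij (F : fieldType) (K : closedFieldType)
    (iota : {rmorphism F -> K}) (sigma : {rmorphism K -> K}) :
    (forall x : K, algebraicOver iota x) ->
    (forall a, sigma (iota a) = iota a) ->
  bijective sigma.
Proof.
move=> algK fix_sigma.
have surj y : exists x, sigma x = y.
  have [p p_neq0 py0] := algK y.
  have [rs Dp] := closed_field_poly_normal (map_poly iota p).
  have rootE z : root (map_poly iota p) z = (z \in undup rs).
    rewrite Dp rootZ ?lead_coef_eq0 ?map_poly_eq0 //.
    by rewrite root_prod_XsubC mem_undup.
  have sub_rs : {subset map sigma (undup rs) <= undup rs}.
    move=> _ /mapP[z z_rs ->]; rewrite -rootE.
    suff -> : map_poly iota p = map_poly sigma (map_poly iota p).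
      by rewrite fmorph_root rootE.
    by rewrite -map_poly_comp; apply/polyP=> i; rewrite !coef_map /= fix_sigma.
  have uniq_map : uniq (map sigma (undup rs)).
    by rewrite map_inj_uniq ?undup_uniq //; apply: fmorph_inj.
  have [|_ eq_rs] := uniq_min_size uniq_map sub_rs; first by rewrite size_map.
  have: y \in map sigma (undup rs) by rewrite eq_rs -rootE.
  by case/mapP=> x _ ->; exists x.
have [g gK] := boolp.choice surj.
by exists g => // x; apply: (fmorph_inj sigma); rewrite gK.
Qed.

(** * Schur orthogonality and separation by irreducible representations *)

Section Schur.
Variables (K : closedFieldType) (gT : finGroupType).
Hypothesis char0 : [pchar K] =i pred0.
Local Notation repr := (mx_representation K [set: gT]).

Lemma irr_abs_irr n (r : repr n) :
  mx_irreducible r -> mx_absolutely_irreducible r.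
Proof. exact: group_closure_closed_field. Qed.

Lemma natr_neq0 n : (0 < n)%N -> n%:R != 0 :> K.
Proof.
move/prednK <-; rewrite natf_neq0_pchar.
by apply/pnatP => // q _ _; rewrite inE char0.
Qed.

Lemma group_order_neq0 : #|gT|%:R != 0 :> K.
Proof. by apply: natr_neq0; apply/card_gt0P; exists 1%g. Qed.

(** Schur's lemma: the kernel of [B] is a proper submodule, hence zero, and its image is a nonzero
    submodule, hence everything. *)
Lemma irr_hom_rsim n1 n2 (r1 : repr n1) (r2 : repr n2) (B : 'M_(n1, n2)) :
    mx_irreducible r1 -> mx_irreducible r2 ->
    (forall g, r1 g *m B = B *m r2 g) -> B != 0 ->
  mx_rsim r1 r2.
Proof.
move=> /mx_irrP[n1_gt0 irr1] /mx_irrP[n2_gt0 irr2] homB B_neq0.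
have freeB : row_free B.
  rewrite -kermx_eq0; apply: contraNT B_neq0 => /irr1 -/(_ _)/row_fullP[].
    apply/mxmoduleP=> g _; apply/sub_kermxP.
    by rewrite -mulmxA homB mulmxA mulmx_ker mul0mx.
  by move=> C CK; rewrite -[B]mul1mx -CK -mulmxA mulmx_ker mulmx0.
have fullB : row_full <<B>>%MS.
  apply: irr2; last by rewrite -mxrank_eq0 genmxE mxrank_eq0.
  apply/mxmoduleP=> g _; rewrite (eqmxMr _ (genmxE B)) genmxE -homB.
  exact: submxMl.
have eq_n : n1 = n2.
  by move: freeB fullB; rewrite /row_free /row_full genmxE => /eqP -> /eqP.
by exists B.
Qed.

Lemma mulmx_delta m n p q (A : 'M[K]_(m, n)) (B : 'M[K]_(p, q)) a b i j :
  (A *m delta_mx a b *m B) i j = A i a * B b j.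
Proof.
rewrite -(mul_delta_mx (0 : 'I_1)) mulmxA -mulmxA -colE -rowE mxE big_ord1.
by rewrite !mxE.
Qed.

(** * Intertwining matrices obtained by averaging over the group *)

Section Average.
Variables (n1 n2 : nat) (r1 : repr n1) (r2 : repr n2).

Definition rep_average (M : 'M[K]_(n1, n2)) : 'M[K]_(n1, n2) :=
  \sum_g r1 g^-1%g *m M *m r2 g.

Lemma rep_averageJ M g : r1 g *m rep_average M = rep_average M *m r2 g.
Proof.
rewrite mulmx_sumr mulmx_suml (reindex_inj (mulIg g)) /=; apply: eq_bigr => h _.
rewrite repr_mxM ?inE // !mulmxA -repr_mxM ?inE // invMg.
by rewrite mulgA mulgV mul1g.
Qed.

(** Averages of elementary matrices express the entries of a character sum through intertwining
    matrices, to which Schur's lemma applies. *)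
Lemma trace_sum_entry b j :
  (\sum_g \tr (r1 g^-1%g) *: r2 g) b j = \sum_a rep_average (delta_mx a b) a j.
Proof.
rewrite summxE; under [RHS]eq_bigr => a _ do rewrite summxE.
rewrite exchange_big /=; apply: eq_bigr => g _; rewrite mxE mulr_suml.
by apply: eq_bigr => a _; rewrite mulmx_delta.
Qed.

End Average.

Lemma trace_sum_nonsim n1 n2 (r1 : repr n1) (r2 : repr n2) :
    mx_irreducible r1 -> mx_irreducible r2 -> ~ mx_rsim r1 r2 ->
  \sum_g \tr (r1 g^-1%g) *: r2 g = 0.
Proof.
move=> irr1 irr2 nsim; apply/matrixP=> b j.
rewrite trace_sum_entry mxE big1 // => a _.
have [-> | nz] := eqVneq (rep_average r1 r2 (delta_mx a b)) 0.
  by rewrite mxE.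
by case: nsim; apply: irr_hom_rsim nz => // g; apply: rep_averageJ.
Qed.

(** Each average is a scalar matrix by Schur's lemma, and taking traces determines [n] times the
    scalar; elementary matrices then give the sum. *)
Lemma trace_sum_same n (r : repr n) : mx_irreducible r ->
  n%:R *: \sum_g \tr (r g^-1%g) *: r g = #|gT|%:R%:M.
Proof.
move=> irr; have abs := irr_abs_irr irr.
have avg M : n%:R *: rep_average r r M = (#|gT|%:R * \tr M)%:M.
  have /is_scalar_mxP[c Dc] : is_scalar_mx (rep_average r r M).
    apply: (mx_abs_irr_cent_scalar abs); apply/centgmxP=> g _.
    by rewrite rep_averageJ.
  rewrite Dc scale_scalar_mx; congr (_%:M).
  rewrite mulr_natl -mxtrace_scalar -Dc /rep_average raddf_sum /=.
  rewrite mulr_natl -sumr_const; apply: eq_bigr => g _.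
  by rewrite mxtrace_mulC mulmxA -repr_mxM ?inE // mulgV repr_mx1 mul1mx.
apply/matrixP=> b j; rewrite mxE trace_sum_entry mulr_sumr.
under eq_bigr => a _.
  have -> : n%:R * rep_average r r (delta_mx a b) a j
          = (n%:R *: rep_average r r (delta_mx a b)) a j by rewrite mxE.
  rewrite avg mxE; over.
rewrite (bigD1 j) //= big1 ?addr0 => [|a /negPf neq_a]; last first.
  by rewrite neq_a mulr0n.
rewrite eqxx mulr1n mxE -(mul_delta_mx (0 : 'I_1)) mxtrace_mulC.
rewrite mul_delta_mx_cond eq_sym; case: eqP => _.
  by rewrite trace_mx11 mxE !eqxx mulr1.
by rewrite mulr0n mxtrace0 mulr0.
Qed.

(** For non-similar representations the character sum vanishes, but for equal characters [n2] times
    it is the scalar [#|gT|], which is nonzero. *)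
Lemma irr_rsim_trace n1 n2 (r1 : repr n1) (r2 : repr n2) :
    mx_irreducible r1 -> mx_irreducible r2 ->
  (forall g, \tr (r1 g) = \tr (r2 g)) -> mx_rsim r1 r2.
Proof.
move=> irr1 irr2 eq_tr; apply: boolp.contrapT => nsim.
have := trace_sum_same irr2; under eq_bigr => g _ do rewrite -eq_tr.
rewrite trace_sum_nonsim // scaler0 => /matrixP.
have /mx_irrP[n2_gt0 _] := irr2; move=> /(_ (Ordinal n2_gt0) (Ordinal n2_gt0)).
by rewrite !mxE eqxx => /esym/eqP; rewrite (negPf group_order_neq0).
Qed.

(** By Maschke's theorem the regular module is a sum of simple modules, so [z] acts on it as
    zero. *)
Lemma irr_separate (z : gT -> K) :
    (forall n (r : repr n), mx_irreducible r -> \sum_g z g *: r g = 0) ->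
  forall g, z g = 0.
Proof.
move=> z0; pose rG := regular_repr K [set: gT]; pose Z := \sum_g z g *: rG g.
have regZ : Z = 0.
  have mod1 := mxmodule1 rG.
  have p'G : pgroup [pchar K]^' [set: gT]%G.
    by apply/pgroupP=> q _ _; rewrite inE /= char0.
  apply/eqP; apply: (mx_reducible_semisimple mod1 (mx_Maschke_pchar rG p'G)).
  case=> I U W simU defW _; rewrite -[Z]mul1mx; apply/eqP/sub_kermxP.
  rewrite -defW; apply/sumsmx_subP => i _; have [modU _ _] := simU i.
  rewrite -(val_submod1 (U i)); apply/sub_kermxP; rewrite mulmx_sumr.
  under eq_bigr => g _.
    rewrite -scalemxAr -(val_submodJ modU) ?inE // mul1mx -linearZ; over.
  rewrite -linear_sum /=.
  have /(z0 _ (submod_repr modU)) := (submod_mx_irr modU).2 (simU i).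
  by move=> /= ->; rewrite linear0.
(* In the regular representation [gring_proj g] reads off the coefficient at [g]. *)
move=> g; have := congr1 (@gring_proj K gT [set: gT]%G g) regZ.
rewrite linear_sum linear0 (bigD1 g) //= linearZ /= gring_projE ?inE // eqxx.
rewrite big1 => [|h neq_h]; last first.
  by rewrite linearZ /= gring_projE ?inE // eq_sym (negPf neq_h) scaler0.
by rewrite addr0 scalemx1 => /matrixP/(_ 0 0)/eqP; rewrite !mxE mulr1n => /eqP.
Qed.

End Schur.

(** * The representations of the group algebra *)

Lemma descendK (A : zmodType) (B : Type) (f : A -> B) x :
  f (descend f (f x)) = f x.
Proof.
by apply: (@classical_sets.xgetPex _ 0 (fun y => f y = f x)); exists x.
Qed.

Lemma descend_junk (A : zmodType) (B : Type) (f : A -> B) y :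
  (forall x, f x <> y) -> descend f y = 0.
Proof. by move=> nfy; apply: classical_sets.xgetPN. Qed.

Section GroupAlgebra.
Variables (R : nzRingType) (gT : finGroupType).
Implicit Types a b : galg R gT.

Lemma galgME a b g : (a * b) g = \sum_h a h * b (h^-1 * g)%g.
Proof. by rewrite [LHS]ffunE. Qed.

Lemma galg1E g : (1 : galg R gT) g = (g == 1%g)%:R.
Proof. by rewrite [LHS]ffunE. Qed.

End GroupAlgebra.

Section RepExt.
Variables (F : fieldType) (Fbar : closedFieldType).
Variable iota : {rmorphism F -> Fbar}.
Variables (gT : finGroupType) (chi : irrchar iota gT).

Lemma rep_ext_is_zmod_morphism : zmod_morphism (rep_ext chi).
Proof.
move=> a b; rewrite /rep_ext -sumrB; apply: eq_bigr => g _.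
by rewrite !ffunE rmorphB scalerBl.
Qed.

Lemma rep_ext_is_monoid_morphism : monoid_morphism (rep_ext chi).
Proof.
split=> [|a b].
  rewrite /rep_ext (bigD1 1%g) //= galg1E eqxx rmorph1 scale1r repr_mx1.
  rewrite big1 ?addr0 // => g /negPf neq_g.
  by rewrite galg1E neq_g rmorph0 scale0r.
rewrite /rep_ext [RHS]mulmx_suml.
under [LHS]eq_bigr => g _ do rewrite galgME rmorph_sum scaler_suml.
rewrite exchange_big; apply: eq_bigr => h _ /=; rewrite mulmx_sumr.
rewrite (reindex_inj (mulgI h)) /=; apply: eq_bigr => g _.
by rewrite mulKg rmorphM repr_mxM ?inE // -scalemxAl -scalemxAr scalerA.
Qed.

HB.instance Definition _ := GRing.isZmodMorphism.Build _ _ (rep_ext chi)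
  rep_ext_is_zmod_morphism.
HB.instance Definition _ := GRing.isMonoidMorphism.Build _ _ (rep_ext chi)
  rep_ext_is_monoid_morphism.

End RepExt.

(** * Conjugate characters and the action of the centre *)

Section Characters.
Variables (F : fieldType) (Fbar : closedFieldType).
Variable iota : {rmorphism F -> Fbar}.
Hypothesis char0 : [pchar F] =i pred0.
Hypothesis halg : forall x : Fbar, algebraicOver iota x.
Variable gT : finGroupType.

Lemma closure_char0 : [pchar Fbar] =i pred0.
Proof. by move=> p; rewrite (fmorph_pchar iota). Qed.

Lemma extension_galois (L : splittingFieldType F) : galois 1 {:L}.
Proof.
apply/and3P; split; [exact: sub1v | | exact: normalFieldf].
apply/separableP=> x _; apply: pcharf0_separable => p.
by rewrite (fmorph_pchar (in_alg L)).
Qed.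

Section OneCharacter.
Variable chi : irrchar iota gT.
Let L := ic_field chi.
Let rho := ic_rep chi.

(** The defining sum is a rational multiple of a trace, hence lies in the image of [F], and
    [descend] does not return its junk value. *)
Lemma center_embE (a : L) g :
  (center_emb a g)%:A =
    (ic_deg chi)%:R / #|gT|%:R * galTrace 1 {:L} (a * ic_val chi g^-1%g).
Proof.
rewrite ffunE; set c := _ / _.
have -> : \sum_(s in 'Gal({:L} / 1%AS)%g) s a * c * s (ic_val chi g^-1%g)
          = c * galTrace 1 {:L} (a * ic_val chi g^-1%g).
  rewrite /galTrace mulr_sumr; apply: eq_bigr => s _.
  by rewrite rmorphM /= -mulrA mulrCA.
have: c * galTrace 1 {:L} (a * ic_val chi g^-1%g) \in 1%VS.
  have trK := mem_galTrace (extension_galois L) (memvf (a * ic_val chi g^-1%g)).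
  have cK : c \in 1%AS by apply: rpred_div; apply: rpred_nat.
  exact: (memvM (A := 1%AS) cK trK).
by case/vlineP=> k ->; apply: (descendK (in_alg L)).
Qed.

(** Coefficients of the primitive central idempotent of the group algebra over [Fbar] attached to
    the conjugate of the character by [s]. *)
Definition conj_idem (s : gal_of {:L}) (g : gT) : Fbar :=
  (ic_deg chi)%:R / #|gT|%:R * ic_emb chi (s (ic_val chi g^-1%g)).

Lemma iota_center_emb (a : L) g :
  iota (center_emb a g) = \sum_(s in 'Gal({:L} / 1%AS)%g)
     ic_emb chi (s a) * conj_idem s g.
Proof.
rewrite -(ic_embF chi) center_embE rmorphM fmorph_div !rmorph_nat rmorph_sum.
by rewrite mulr_sumr; apply: eq_bigr => s _; rewrite !rmorphM mulrCA.
Qed.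

(** The lift [sigma], applied to matrix entries, provides a representation affording the conjugate
    character. *)
Lemma extend_gal (s : gal_of {:L}) : exists sigma : {rmorphism Fbar -> Fbar},
  [/\ bijective sigma, forall a, sigma (iota a) = iota a &
      forall x : L, sigma (ic_emb chi x) = ic_emb chi (s x)].
Proof.
have algL x : algebraicOver (ic_emb chi) x.
  have [p p_neq0 px0] := halg x; exists (map_poly (in_alg L) p).
    by rewrite map_poly_eq0.
  rewrite -map_poly_comp; congr (root _ x): px0.
  by apply: eq_map_poly => a /=; rewrite ic_embF.
have [sigma Ds] := extend_rmorphism (ic_emb chi \o s) algL.
have fix_iota a : sigma (iota a) = iota a.
  by rewrite -(ic_embF chi) Ds /= rmorph_alg.
by exists sigma; split=> //; apply: algebraic_endo_bij halg fix_iota.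
Qed.

Lemma map_repr_irr (sigma : {rmorphism Fbar -> Fbar}) n
    (r : mx_representation Fbar [set: gT] n) :
  mx_irreducible r -> mx_irreducible (map_repr sigma r).
Proof.
by move=> irr; apply: mx_abs_irrW; rewrite map_mx_abs_irr; apply: irr_abs_irr.
Qed.

(** The fixed field of [s] contains the character values, which generate [L]. Thus a nontrivial [s]
    moves the character. *)
Lemma gal_fix_char (s : gal_of {:L}) :
  (forall g, s (ic_val chi g) = ic_val chi g) -> s = 1%g.
Proof.
move=> fix_s; apply/eqP/gal_eqP => x _; rewrite gal_id.
have: x \in fixedField [set s].
  suff /subvP : (<<1 & [seq ic_val chi g | g <- enum gT]>>
                   <= fixedField [set s])%VS.
    by apply; rewrite ic_gen memvf.
  apply/Fadjoin_seqP; split; first exact: sub1v.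
  move=> _ /mapP[g _ ->]; apply/fixedFieldP; first exact: memvf.
  by move=> t /set1P ->.
by case/mem_fixedFieldP => _ /(_ s); apply; rewrite inE.
Qed.

(** Schur orthogonality between [r] and the representation affording the conjugate character; equal
    characters mean similar representations. *)
Lemma conj_idem_rep (s : gal_of {:L}) n
    (r : mx_representation Fbar [set: gT] n) :
    mx_irreducible r ->
  ((forall g, ic_emb chi (s (ic_val chi g)) = \tr (r g)) ->
     \sum_g conj_idem s g *: r g = 1%:M)
  /\ (~ (forall g, ic_emb chi (s (ic_val chi g)) = \tr (r g)) ->
     \sum_g conj_idem s g *: r g = 0).
Proof.
move=> irr_r; have [sigma [_ _ Ds]] := extend_gal s.
have irr1 := map_repr_irr sigma (ic_irr chi).
have tr1 g : ic_emb chi (s (ic_val chi g)) = \tr (map_repr sigma rho g).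
  by rewrite map_reprE -Ds ic_valE trace_map_mx.
have K0 := closure_char0.
under [X in X = 1%:M]eq_bigr => g _ do rewrite -scalerA tr1.
under [X in X = 0]eq_bigr => g _ do rewrite -scalerA tr1.
rewrite -!scaler_sumr; split=> [eq_tr | neq_tr].
  have sim : mx_rsim (map_repr sigma rho) r.
    by apply: irr_rsim_trace => // g; rewrite -tr1.
  under eq_bigr => g _ do rewrite -tr1 eq_tr.
  rewrite (mxrank_rsim sim) mulrC -scalerA trace_sum_same //.
  rewrite scale_scalar_mx mulVf //.
  exact: group_order_neq0.
rewrite trace_sum_nonsim ?scaler0 // => sim; apply: neq_tr => g.
by rewrite tr1 (mxtrace_rsim sim) ?inE.
Qed.

End OneCharacter.

Lemma rep_ext_conj_sum (chi chi' : irrchar iota gT) (a : ic_field chi) :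
  rep_ext chi' (center_emb a) = \sum_(s in 'Gal({:ic_field chi} / 1%AS)%g)
    ic_emb chi (s a) *: \sum_g conj_idem s g *: ic_rep chi' g.
Proof.
rewrite /rep_ext; under eq_bigr => g _ do rewrite iota_center_emb scaler_suml.
rewrite exchange_big; apply: eq_bigr => s _ /=.
by rewrite scaler_sumr; apply: eq_bigr => g _; rewrite scalerA.
Qed.

(** Only [s = 1] contributes: any other [s] gives a different character, whose idempotent is
    killed. *)
Lemma rep_ext_center_emb (chi : irrchar iota gT) (a : ic_field chi) :
  rep_ext chi (center_emb a) = (ic_emb chi a)%:M.
Proof.
rewrite rep_ext_conj_sum (bigD1 1%g) ?group1 //=.
rewrite [X in _ + X]big1 => [|s /andP[_ s_neq1]].
  rewrite addr0 gal_id (conj_idem_rep 1%g (ic_irr chi)).1 ?scalemx1 // => g.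
  by rewrite gal_id ic_valE.
rewrite (conj_idem_rep s (ic_irr chi)).2 ?scaler0 // => fix_s; case/eqP: s_neq1.
apply: gal_fix_char => g; apply: (fmorph_inj (ic_emb chi)).
by rewrite fix_s ic_valE.
Qed.

Section Representatives.
Variables (k : nat) (chi : 'I_k -> irrchar iota gT).
Hypothesis hchi : galois_representatives chi.

(** No conjugate of [chi j] has the character of [chi i], since the representatives are pairwise
    non-conjugate. *)
Lemma rep_ext_center_emb_neq i j (a : ic_field (chi j)) :
  i != j -> rep_ext (chi i) (center_emb a) = 0.
Proof.
move=> neq_ij; rewrite rep_ext_conj_sum big1 // => s _.
rewrite (conj_idem_rep s (ic_irr (chi i))).2 ?scaler0 // => eq_tr.
case/eqP: neq_ij; apply/esym/hchi.2.
have [sigma [bij_s fix_s Ds]] := extend_gal s.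
by exists sigma; split=> // g; rewrite -eq_tr -Ds ic_valE.
Qed.

(** Every irreducible representation is similar to a conjugate of some [ic_rep (chi i)] by a [sigma]
    fixing [F]. An element with coefficients in [F] acts there as the image under [sigma] of its
    action in [chi i], so [irr_separate] applies. *)
Lemma rep_ext_inj (a b : galg F gT) :
  (forall i, rep_ext (chi i) a = rep_ext (chi i) b) -> a = b.
Proof.
move=> eq_ab; apply/eqP; rewrite -subr_eq0; apply/eqP; set c := a - b.
have c0 i : rep_ext (chi i) c = 0 by rewrite rmorphB /= eq_ab subrr.
apply/ffunP=> g; apply: (fmorph_inj iota); rewrite [in RHS]ffunE rmorph0.
apply: (@irr_separate _ gT closure_char0 (fun g => iota (c g))) => n r irr_r.
have [i [sigma [_ fix_s tr_r]]] := hchi.1 _ r irr_r.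
have sim : mx_rsim r (map_repr sigma (ic_rep (chi i))).
  apply: irr_rsim_trace (map_repr_irr sigma (ic_irr (chi i))) _ => //.
    exact: closure_char0.
  by move=> h; rewrite tr_r map_reprE trace_map_mx.
have [B [B' _ Dr]] := mx_rsim_def sim.
under eq_bigr => h _.
  rewrite Dr ?inE // scalemxAl scalemxAr -fix_s map_reprE -map_mxZ; over.
rewrite -mulmx_suml -mulmx_sumr -map_mx_sum -/(rep_ext _ _) c0.
by rewrite map_mx0 mulmx0 mul0mx.
Qed.

End Representatives.
End Characters.

(** * Integrality *)

(** The characteristic polynomial is a product of factors ['X - r] with [r] an eigenvalue, and
    integral elements form a ring. *)
Lemma integral_char_poly (R : comNzRingType) (K : closedFieldType)
    (f : {rmorphism R -> K}) n (A : 'M[K]_n) :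
    (forall x, eigenvalue A x -> integralOver f x) ->
  forall i, integralOver f (char_poly A)`_i.
Proof.
move=> intA; have [rs Dp] := closed_field_poly_normal (char_poly A).
rewrite (monicP (char_poly_monic A)) scale1r in Dp.
have intrs : {in rs, forall x, integralOver f x}.
  by move=> x; rewrite -root_prod_XsubC -Dp -eigenvalue_root_char; apply: intA.
rewrite {}Dp; elim: rs intrs => [|r rs IHrs] intrs i.
  by rewrite big_nil coef1; apply: integral_nat.
have /IHrs int_rs : {in rs, forall x, integralOver f x}.
  by move=> x rs_x; apply: intrs; rewrite inE rs_x orbT.
rewrite big_cons mulrBl coefB coefXM coefCM; apply: integral_sub.
  by case: eqP => _; [apply: integral0 | apply: int_rs].
by apply: integral_mul (int_rs i); apply: intrs; rewrite mem_head.
Qed.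

Section LocalIntegers.
Variables (F : fieldType) (v : F -> int).

Fact valring_subring : local_field v -> subring_closed (valring v).
Proof.
move=> hF.
have v1 : v 1 = 0.
  have := Defs.valM hF (oner_neq0 F) (oner_neq0 F).
  by rewrite mulr1 -{1}[v 1]addr0 => /addrI.
have N1_neq0 : (-1 : F) != 0 by rewrite oppr_eq0 oner_neq0.
have vN1 : v (-1) = 0.
  have /eqP := Defs.valM hF N1_neq0 N1_neq0.
  by rewrite mulrNN mulr1 v1 -mulr2n eq_sym mulrn_eq0 => /eqP.
have vM x y : x \in valring v -> y \in valring v -> x * y \in valring v.
  rewrite !inE; have [-> | x_neq0] := eqVneq x 0; first by rewrite mul0r eqxx.
  have [-> | y_neq0] := eqVneq y 0; first by rewrite mulr0 eqxx.
  by move=> /= vx vy; rewrite (Defs.valM hF) // addr_ge0 ?orbT.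
have vN x : x \in valring v -> - x \in valring v.
  by move=> vx; rewrite -mulN1r; apply: vM => //; rewrite inE vN1 lexx orbT.
split=> // [|x y vx /vN]; first by rewrite inE v1 lexx orbT.
move: (- y) vx => {}y; rewrite !inE.
have [-> | x_neq0] := eqVneq x 0; first by rewrite add0r.
have [-> | y_neq0] := eqVneq y 0; first by rewrite addr0 (negPf x_neq0).
have [// | xy_neq0] := eqVneq (x + y) 0; move=> /= vx vy.
by apply: le_trans (Defs.valD hF x_neq0 y_neq0 xy_neq0); rewrite le_min vx.
Qed.

Variable hF : local_field v.

(* Copies of valring and intgalg that carry the proof of closure. *)
Definition valring_of of local_field v : {pred F} := valring v.

HB.instance Definition _ :=
  GRing.isSubringClosed.Build F (valring_of hF) (valring_subring hF).

Definition intring := {x : F | x \in valring_of hF}.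
HB.instance Definition _ := Choice.on intring.
HB.instance Definition _ := SubType.on intring.
HB.instance Definition _ := [SubChoice_isSubComNzRing of intring by <:].

Definition intgalg_of {gT : finGroupType} of local_field v :
  {pred galg F gT} := intgalg v.

Lemma intgalgP gT (a : galg F gT) :
  reflect (forall g, a g \in valring v) (a \in intgalg_of hF).
Proof. exact: forallP. Qed.

Fact intgalg_subring gT : subring_closed (@intgalg_of gT hF).
Proof.
split=> [|a b /intgalgP va /intgalgP vb|a b /intgalgP va /intgalgP vb].
- by apply/intgalgP=> g; rewrite galg1E; apply: (rpred_nat (valring_of hF)).
- apply/intgalgP=> g; rewrite !ffunE.
  exact: (rpredB (va g : a g \in valring_of hF)).
apply/intgalgP=> g; rewrite galgME; apply: (@rpred_sum _ (valring_of hF)) => h _.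
by apply: (rpredM (va h : a h \in valring_of hF)).
Qed.

HB.instance Definition _ gT :=
  GRing.isSubringClosed.Build (galg F gT) (intgalg_of hF) (@intgalg_subring gT).

(** Passing to coefficients in the subring type [intring] makes the closure properties of
    [integralOver] available. *)
Lemma integralOver_valring (K : nzRingType) (f : {rmorphism F -> K}) x :
  integralOver (f \o val : intring -> K) x <->
  exists q : {poly F}, [/\ q \is monic, q \is a polyOver (valring v) &
                           root (map_poly f q) x].
Proof.
split=> [[q mon_q qx0] | [q [mon_q Oq qx0]]].
  exists (map_poly val q); split; first exact: monic_map.
    by apply/(@polyOverP _ (valring_of hF))=> i; rewrite coef_map; apply: valP.
  by rewrite -map_poly_comp.
have [q' Dq] : exists q' : {poly intring}, map_poly val q' = q.
  exists (\poly_(i < size q) insubd (0 : intring) q`_i).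
  apply/polyP=> i; rewrite coef_map coef_poly; case: ltnP => le_qi.
    by rewrite /= insubdK //; apply: (@polyOverP _ (valring_of hF) _ Oq).
  by rewrite raddf0 nth_default.
exists q'; last by rewrite map_poly_comp Dq.
rewrite monicE -(inj_eq val_inj) -(lead_coef_map_inj val_inj) ?raddf0 // Dq.
by rewrite rmorph1.
Qed.

Lemma ringint_integral (L : splittingFieldType F) (x : L) :
  ringint v x <-> integralOver (in_alg L \o val : intring -> L) x.
Proof. by split=> /(integralOver_valring (in_alg L)). Qed.

Lemma ringint0 (L : splittingFieldType F) : ringint v (0 : L).
Proof. by apply/ringint_integral/integral0. Qed.

Lemma ringint1 (L : splittingFieldType F) : ringint v (1 : L).
Proof. by apply/ringint_integral/integral1. Qed.

Lemma ringintM (L : splittingFieldType F) (x y : L) :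
  ringint v x -> ringint v y -> ringint v (x * y).
Proof.
move=> /ringint_integral int_x /ringint_integral int_y.
exact/ringint_integral/integral_mul.
Qed.

Variables (Fbar : closedFieldType) (iota : {rmorphism F -> Fbar}).
Variables (gT : finGroupType) (chi : irrchar iota gT).

(* No need to know that x lies in the field of values: otherwise descend gives
   the junk value 0. *)
Lemma ringint_descend (x : Fbar) :
  integralOver (iota \o val : intring -> Fbar) x ->
  ringint v (descend (ic_emb chi) x).
Proof.
move=> int_x.
have [[y Dy] | nx] := boolp.pselect (exists y, ic_emb chi y = x); last first.
  by rewrite descend_junk => [|y Dy]; [apply: ringint0 | apply: nx; exists y].
have [q [mon_q Oq qx0]] := (integralOver_valring iota x).1 int_x.
exists q; split=> //; move: qx0; rewrite -Dy -(fmorph_root (ic_emb chi)).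
rewrite descendK -map_poly_comp; congr (root _ _).
by apply: eq_map_poly => a; rewrite /= ic_embF.
Qed.

(* A left eigenvector w with blocks w_i yields, through the coordinates of the
   w_i rho(g), an eigenvector of a matrix over the valuation ring indexed by
   'I_b * gT. *)
Lemma eigenvalue_block_integral b (H : 'M[galg F gT]_b) x :
    H \is a mxOver (intgalg v) ->
    eigenvalue (\mxblock_(i < b, j < b) rep_ext chi (H i j)) x ->
  integralOver (iota \o val : intring -> Fbar) x.
Proof.
move=> /mxOverP intH /eigenvalueP[w wM w_neq0].
pose u i := submxrow w i.
have eq_u j : \sum_i u i *m rep_ext chi (H i j) = x *: u j.
  have := congr1 (fun A => submxrow A j) wM.
  rewrite -{1}[w]submxrowK mul_mxrow_mxblock mxrowK => ->.
  by apply/matrixP=> a c; rewrite !mxE.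
(* The coordinate [c] is fixed from here on; the entry of [y] at [(j0, 1)] is then nonzero. *)
have [j0 [c uc_neq0]] : exists j c, u j 0 c != 0.
  apply: boolp.contrapT => u0; case/eqP: w_neq0; rewrite -[w]submxrowK.
  rewrite -[RHS]submxrowK; congr (mxrow _); apply: boolp.funext => j /=.
  apply/rowP=> c; rewrite [RHS]mxE mxE; apply/eqP.
  by apply/negPn/negP => ne; apply: u0; exists j, c; move: ne; rewrite /u !mxE.
pose N := #|{: 'I_b * gT}|; pose idx (n : 'I_N) : 'I_b * gT := enum_val n.
(* Multiplying [rep_ext chi (H i j)] on the right by [ic_rep chi g] shifts group elements, so
   [ic_rep chi h] occurs with the coefficient of [H i j] at [h * g^-1]. *)
pose Q : 'M[intring]_N := \matrix_(m, n)
  insubd (0 : intring) (H (idx m).1 (idx n).1 ((idx m).2 * (idx n).2^-1)%g).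
pose y : 'rV[Fbar]_N := \row_n (u (idx n).1 *m ic_rep chi (idx n).2) 0 c.
exists (char_poly Q); first exact: char_poly_monic.
rewrite (map_char_poly (iota \o val : {rmorphism intring -> Fbar})).
rewrite -eigenvalue_root_char; apply/eigenvalueP; exists y; last first.
  apply: contraNneq uc_neq0 => y0.
  have: y 0 (enum_rank (j0, 1%g)) = 0 by rewrite y0 mxE.
  by rewrite mxE /idx enum_rankK /= repr_mx1 mulmx1 => ->.
have QE m n : map_mx (iota \o val : {rmorphism intring -> Fbar}) Q m n
            = iota (H (idx m).1 (idx n).1 ((idx m).2 * (idx n).2^-1)%g).
  rewrite 2!mxE; congr (iota _); apply: insubdK; exact: (forallP (intH _ _)).
apply/rowP=> n; rewrite mxE [RHS]mxE [y 0 n]mxE.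
under eq_bigr => m _ do rewrite [y 0 m]mxE QE.
case: (idx n) => j g /=.
rewrite (reindex (fun p : 'I_b * gT => enum_rank p)) /=; last first.
  by exists (fun m => enum_val m) => m _; rewrite ?enum_rankK ?enum_valK.
under eq_bigr => p _ do rewrite /idx enum_rankK.
rewrite -(pair_bigA _ (fun i h =>
  (u i *m ic_rep chi h) 0 c * iota (H i j (h * g^-1)%g))) /=.
transitivity ((x *: u j *m ic_rep chi g) 0 c); last by rewrite -scalemxAl mxE.
rewrite -eq_u mulmx_suml summxE; apply: eq_bigr => i _.
rewrite (reindex_inj (mulIg g)) /= -mulmxA /rep_ext mulmx_suml mulmx_sumr summxE.
apply: eq_bigr => h _; rewrite mulgK repr_mxM ?inE //.
by rewrite -scalemxAl -scalemxAr [RHS]mxE mulrC.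
Qed.

Lemma ringint_red_char_poly b (H : 'M[galg F gT]_b) i :
    H \is a mxOver (intgalg v) ->
  ringint v (map_poly (descend (ic_emb chi))
    (char_poly (\mxblock_(i < b, j < b) rep_ext chi (H i j))))`_i.
Proof.
(* [descend] is a bare function here; coefficients of [map_poly] can be read off because it sends 0
   to 0. *)
move=> intH; rewrite coef_map_id0; last first.
  by apply: (fmorph_inj (ic_emb chi)); rewrite -{1}(rmorph0 (ic_emb chi)) descendK.
apply: ringint_descend; apply: (integral_char_poly (f := iota \o val)).
by move=> x; apply: eigenvalue_block_integral.
Qed.

End LocalIntegers.

(** * Adjugates *)

(** The constant coefficient of the adjugate of [X - A] is computed in two ways: by a recurrence on
    its coefficients, and by evaluation at [X = 0]. *)
Lemma adj_char_poly (R : comNzRingType) n (A : 'M[R]_n) :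
  \adj A = (-1) ^+ n.+1 *: \sum_(1 <= j < n.+1) (char_poly A)`_j *: A ^+ j.-1.
Proof.
case: n A => [|n] A; first by rewrite [LHS]flatmx0 [RHS]flatmx0.
pose adjX := \adj (char_poly_mx A).
pose B k : 'M[R]_n.+1 := \matrix_(i, j) (adjX i j)`_k.
(* Compare the coefficients in (X - A) adj(X - A) = char_poly A. *)
have recB k : B k = ((char_poly A)`_k.+1)%:M + A *m B k.+1.
  have := mul_mx_adj (char_poly_mx A); rewrite -/adjX -/(char_poly A).
  rewrite /char_poly_mx mulmxBl mul_scalar_mx => /matrixP eq_adj.
  apply/matrixP=> i j; have /(congr1 (fun p : {poly R} => p`_k.+1)) := eq_adj i j.
  rewrite !mxE coefB coefXM /= coef_sum coefMn => /eqP; rewrite subr_eq => /eqP ->.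
  by congr (_ + _); apply: eq_bigr => l _; rewrite !mxE coefCM.
have B0 N : B 0%N =
    \sum_(1 <= j < N.+1) (char_poly A)`_j *: A ^+ j.-1 + A ^+ N * B N.
  elim: N => [|N IHN]; first by rewrite big_geq // add0r mul1r.
  rewrite [LHS]IHN [in RHS]big_nat_recr //= -addrA; congr (_ + _).
  by rewrite recB mulrDr -[_%:M]scalemx1 -scalerAr mulr1 mulmxE mulrA -exprSr.
(* Large enough for [B N] to vanish; being at least [n.+1], it extends the sum only by zero
   coefficients of [char_poly A]. *)
pose N := maxn n.+1 (\max_i \max_j size (adjX i j)).
have BN : B N = 0.
  apply/matrixP=> i j; rewrite [LHS]mxE [RHS]mxE nth_default // leq_max.
  apply/orP; right.
  apply: leq_trans (leq_bigmax (F := fun l => \max_l' size (adjX l l')) i) => /=.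
  exact: (leq_bigmax (F := fun l => size (adjX i l)) j).
have -> : \sum_(1 <= j < n.+2) (char_poly A)`_j *: A ^+ j.-1 = B 0%N.
  rewrite (B0 N) BN mulr0 addr0 (@big_cat_nat _ _ _ n.+2 1 N.+1) //=; last first.
    by rewrite ltnS leq_maxl.
  rewrite [X in _ = _ + X]big_nat_cond [X in _ = _ + X]big1 ?addr0 //.
  move=> j /andP[/andP[lt_j _] _].
  by rewrite nth_default ?scale0r // size_char_poly.
(* At [X = 0] one gets the adjugate of [- A], of size [n.+1], whose cofactors are determinants of
   size [n]. *)
have -> : B 0%N = (-1) ^+ n *: \adj A.
  have -> : B 0%N = map_mx (horner_eval 0) adjX.
    by apply/matrixP=> i j; rewrite !mxE /horner_eval horner_coef0.
  rewrite map_mx_adj -adjZ; congr (\adj _); apply/matrixP=> i j.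
  rewrite !mxE /= /horner_eval hornerD hornerN hornerC hornerMn hornerX.
  by rewrite mul0rn sub0r mulN1r.
rewrite scalerA -exprD addSn addSn addnn -mul2n !exprS mulrA mulrNN !mulr1.
by rewrite mul1r exprM sqrrN expr1n expr1n scale1r.
Qed.

(** Rows and columns undergo the same permutation, so the two signs cancel. *)
Lemma char_poly_reindex (R : comNzRingType) m n (f : 'I_m -> 'I_n)
    (A : 'M[R]_n) :
  bijective f -> char_poly (\matrix_(i, j) A (f i) (f j)) = char_poly A.
Proof.
move=> bij_f; have eq_mn : m = n by have := bij_eq_card bij_f; rewrite !card_ord.
case: n / eq_mn f A bij_f => f A /bij_inj inj_f; pose s := perm inj_f.
rewrite /char_poly.
have -> : char_poly_mx (\matrix_(i, j) A (f i) (f j))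
        = col_perm s (row_perm s (char_poly_mx A)).
  by apply/matrixP=> i j; rewrite !mxE !permE (inj_eq inj_f).
rewrite col_permE row_permE !det_mulmx !det_perm odd_permV mulrAC mulrC.
by rewrite -signr_addb addbb mulr1.
Qed.

(** With blocks of size 1, [tagnat.Rank] is a bijective relabelling of the indices. The size is a
    variable [d] because a degree is only provably equal to 1. *)
Lemma char_poly_block1 (R : comNzRingType) b d (B : 'I_b -> 'I_b -> 'M[R]_d) :
  d = 1%N ->
  char_poly (\mxblock_(i < b, j < b) B i j)
    = char_poly (\matrix_(i, j) \tr (B i j)).
Proof.
move=> d1; subst d.
pose f (i : 'I_b) := tagnat.Rank (p_ := fun=> 1%N) i (0 : 'I_1).
have inj_f : injective f.
  by move=> i j /(congr1 tagnat.sig1); rewrite !tagnat.Rank1K.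
have bij_f : bijective f.
  by apply: inj_card_bij => //; rewrite !card_ord sum_nat_const card_ord muln1.
rewrite -(char_poly_reindex _ bij_f); congr char_poly; apply/matrixP=> i j.
by rewrite mxE [RHS]mxE trace_mx11 -[in RHS](mxblockK B i j) [RHS]mxE.
Qed.

(** * Images of the generalized adjoint *)

Lemma mx1_trace (R : pzRingType) n (M : 'M[R]_n) : n = 1%N -> M = (\tr M)%:M.
Proof. by move=> n1; subst n; rewrite trace_mx11 -mx11_scalar. Qed.

Lemma mxtrace_scalar1 (R : pzRingType) n (x : R) :
  n = 1%N -> \tr (x%:M : 'M_n) = x.
Proof. by move->; rewrite mxtrace_scalar mulr1n. Qed.

(** The image [T] is scalar by Schur's lemma, the commutator subgroup being normal. A nonlinear
    character has some [h] of that subgroup outside its kernel, and [ic_rep chi h *m T = T] forces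
    the scalar to be 0. *)
Lemma trace_der_rep_ext (F : fieldType) (Fbar : closedFieldType)
    (iota : {rmorphism F -> Fbar}) (gT : finGroupType) (chi : irrchar iota gT) :
  ic_deg chi != 1%N -> rep_ext chi (trace_der F gT) = 0.
Proof.
move=> d_neq1; pose G' := ([set: gT]^`(1))%g; set T := rep_ext chi _.
have DT : T = \sum_(g in G') ic_rep chi g.
  rewrite [RHS]big_mkcond; apply: eq_bigr => g _.
  rewrite ffunE -/G'; case: (g \in G').
    by rewrite rmorph1 scale1r.
  by rewrite rmorph0 scale0r.
have splitG := @group_closure_closed_field Fbar gT.
have nG' x g : (g ^ x \in G')%g = (g \in G').
  by apply: memJ_norm; apply: (subsetP (gFnorm _ _)); rewrite inE.
have /is_scalar_mxP[c Dc] : is_scalar_mx T.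
  apply: (mx_abs_irr_cent_scalar (irr_abs_irr (ic_irr chi))).
  apply/centgmxP=> x _; rewrite DT mulmx_suml mulmx_sumr.
  rewrite [RHS](reindex_inj (conjg_inj x)) /=.
  apply: eq_big => [g | g _]; first by rewrite nG'.
  by rewrite -!repr_mxM ?inE // conjgC.
have : ~~ (G' \subset rker (ic_rep chi)).
  by rewrite (der1_sub_rker (splitG _) (ic_irr chi)).
case/subsetPn=> h G'h nker_h.
have hT : ic_rep chi h *m T = T.
  rewrite DT mulmx_sumr [RHS](reindex_inj (mulgI h)) /=.
  by apply: eq_big => [g | g _]; rewrite ?groupMl ?repr_mxM ?inE.
have [c0 | c_neq0] := eqVneq c 0; first by rewrite Dc c0 raddf0.
case/rkerP: nker_h; split; first by rewrite inE.
move: hT; rewrite Dc mul_mx_scalar.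
by rewrite -[c%:M]scalemx1 => /(scalerI c_neq0).
Qed.

(** * The generalized adjoint under the representation of its own component *)

Section LinearCharacter.
Variables (F : fieldType) (Fbar : closedFieldType).
Variable iota : {rmorphism F -> Fbar}.
Hypothesis char0 : [pchar F] =i pred0.
Hypothesis halg : forall x : Fbar, algebraicOver iota x.
Variables (gT : finGroupType) (chi : irrchar iota gT).

Lemma rep_ext_idem : rep_ext chi (idem chi) = 1.
Proof. by rewrite /idem rep_ext_center_emb // rmorph1. Qed.

Lemma map_mul_idem b (H : 'M[galg F gT]_b) :
  map_mx (rep_ext chi) (map_mx (fun a => a * idem chi) H)
    = map_mx (rep_ext chi) H.
Proof. by apply/matrixP=> i j; rewrite !mxE rmorphM /= rep_ext_idem mulr1. Qed.

Lemma map_star_component b (H : 'M[galg F gT]_b) (f := red_char_poly chi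
    (map_mx (fun a => a * idem chi) H)) (m := (ic_deg chi * b)%N) :
  map_mx (rep_ext chi) (star_component chi H) =
  (-1) ^+ m.+1 *: \sum_(1 <= j < m.+1)
     (ic_emb chi f`_j)%:M *: map_mx (rep_ext chi) H ^+ j.-1.
Proof.
rewrite /star_component -/f -/m map_mxZ rmorph_sign map_mx_sum; congr (_ *: _).
apply: eq_bigr => j _.
rewrite !map_mxZ /= rep_ext_center_emb // rep_ext_idem scale1r.
by rewrite rmorphXn /= map_mul_idem.
Qed.

Lemma red_char_poly_idem b (H : 'M[galg F gT]_b) :
  red_char_poly chi (map_mx (fun a => a * idem chi) H) =
  map_poly (descend (ic_emb chi))
    (char_poly (\mxblock_(i < b, j < b) rep_ext chi (H i j))).
Proof.
congr (map_poly _ (char_poly _)); apply: eq_mxblock => i j.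
by rewrite mxE rmorphM /= rep_ext_idem mulr1.
Qed.

(** In degree 1 the trace of [rep_ext chi] is a ring morphism to the commutative field [Fbar]. It
    preserves the cofactor formula, and [adj_char_poly] identifies the image. *)
Lemma star_component_linear b (H : 'M[galg F gT]_b) : ic_deg chi = 1%N ->
  map_mx (rep_ext chi) (star_component chi H) = map_mx (rep_ext chi) (\adj H).
Proof.
move=> d1; pose lam a := \tr (rep_ext chi a).
have lamE a : rep_ext chi a = (lam a)%:M by exact: mx1_trace.
have lam_inj (X Y : Fbar) : X%:M = Y%:M :> 'M_(ic_deg chi) -> X = Y.
  by move/(congr1 mxtrace); rewrite !mxtrace_scalar1.
have lamB : zmod_morphism lam by move=> x y; rewrite /lam rmorphB raddfB.
have lamM : monoid_morphism lam.
  split=> [|x y]; first by rewrite /lam rmorph1 mxtrace_scalar1.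
  by apply: lam_inj; rewrite -lamE rmorphM /= !lamE -mulmxE -scalar_mxM.
pose lamA := GRing.isZmodMorphism.Build _ _ lam lamB.
pose lamR := GRing.isMonoidMorphism.Build _ _ lam lamM.
pose la : {rmorphism galg F gT -> Fbar} := HB.pack lam lamA lamR.
suff eq_la : map_mx la (star_component chi H) = map_mx la (\adj H).
  apply/matrixP=> r c; have /matrixP/(_ r c) := eq_la.
  rewrite [LHS]mxE [RHS]mxE => eq_rc.
  by rewrite [LHS]mxE [RHS]mxE !lamE; congr _%:M.
have la_emb (a : ic_field chi) : la (center_emb a) = ic_emb chi a.
  by rewrite /= /lam rep_ext_center_emb // mxtrace_scalar1.
have la_idem : la (idem chi) = 1 by rewrite /idem la_emb rmorph1.
(* The image of [H] comes from the field of values, so the coefficients of its characteristic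
   polynomial lie in the range of [ic_emb chi], where [descend] recovers them. *)
pose A' : 'M[ic_field chi]_b :=
  \matrix_(r, c) \sum_g (H r c g)%:A * ic_val chi g.
have DA : map_mx (ic_emb chi) A' = map_mx la H.
  apply/matrixP=> r c; rewrite !mxE rmorph_sum /= /lam /rep_ext raddf_sum /=.
  by apply: eq_bigr => g _; rewrite rmorphM ic_embF ic_valE mxtraceZ.
rewrite map_mx_adj adj_char_poly /star_component map_mxZ rmorph_sign.
rewrite map_mx_sum d1 mul1n.
congr (_ *: _); apply: eq_bigr => j _; rewrite !map_mxZ la_idem la_emb scale1r.
have DHi : map_mx la (map_mx (fun a => a * idem chi) H) = map_mx la H.
  by apply/matrixP=> r c; rewrite !mxE rmorphM la_idem mulr1.
have -> : map_mx la (map_mx (fun a => a * idem chi) H ^+ j.-1)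
        = map_mx la H ^+ j.-1.
  by rewrite rmorphXn -DHi.
congr (_ *: _).
rewrite red_char_poly_idem char_poly_block1 //.
have -> : \matrix_(i, l) \tr (rep_ext chi (H i l)) = map_mx (ic_emb chi) A'.
  by rewrite DA; apply/matrixP=> r c; rewrite !mxE.
rewrite -DA -map_char_poly coef_map coef_map_id0 ?coef_map ?descendK //.
by apply: (fmorph_inj (ic_emb chi)); rewrite -{1}(rmorph0 (ic_emb chi)) descendK.
Qed.

End LinearCharacter.

(** * Directness and containment *)

Section Containment.
Variables (F : fieldType) (v : F -> int) (hF : local_field v).
Hypothesis char0 : [pchar F] =i pred0.
Variables (Fbar : closedFieldType) (iota : {rmorphism F -> Fbar}).
Hypothesis halg : forall x : Fbar, algebraicOver iota x.
Variables (gT : finGroupType) (k : nat) (chi : 'I_k -> irrchar iota gT).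
Hypothesis hchi : galois_representatives chi.

Lemma map_rep_ext_inj m n (A B : 'M[galg F gT]_(m, n)) :
  (forall i, map_mx (rep_ext (chi i)) A = map_mx (rep_ext (chi i)) B) -> A = B.
Proof.
move=> eqAB; apply/matrixP=> r c; apply: (rep_ext_inj char0 hchi) => i.
by have /matrixP/(_ r c) := eqAB i; rewrite [LHS]mxE [RHS]mxE.
Qed.

Lemma map_star b (H : 'M[galg F gT]_b) i :
  map_mx (rep_ext (chi i)) (star chi H)
    = map_mx (rep_ext (chi i)) (star_component (chi i) H).
Proof.
rewrite /star map_mx_sum (bigD1 i) //= big1 ?addr0 // => j neq_ji.
rewrite /star_component map_mxZ map_mx_sum big1 ?scaler0 // => l _.
by rewrite map_mxZ /= (rep_ext_center_emb_neq char0 halg hchi) ?scale0r // eq_sym.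
Qed.

Lemma mxOver_pow b (H : 'M[galg F gT]_b) n :
  H \is a mxOver (intgalg v) -> H ^+ n \is a mxOver (intgalg_of hF).
Proof.
move=> intH; elim: n => [|n IHn]; last by rewrite exprS -mulmxE; apply: mxOverM.
by apply: mxOver_scalar; rewrite ?rpred0 ?rpred1.
Qed.

Lemma mxOver_adj b (H : 'M[galg F gT]_b) :
  H \is a mxOver (intgalg v) -> \adj H \is a mxOver (intgalg_of hF).
Proof.
move=> intH; apply/mxOverP=> r c; rewrite mxE /cofactor.
apply: rpredM; first by apply: rpred_sign.
apply: rpred_sum => s _; apply: rpredM; first by apply: rpred_sign.
by apply: rpred_prod => i _; rewrite !mxE; apply: (mxOverP intH).
Qed.

(** * The summand attached to one character *)

Section CharSummand.
Variable i : 'I_k.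
Let L := ic_field (chi i).
Let dL : L := (#|gT|%:R / (ic_deg (chi i))%:R).

Definition summand_coef (y : L) : Prop :=
  mul_ideal (inv_ideal v (@val_ideal F v _ _ _ (chi i)))
            (@inv_different F v L) y.

(** The integral factor is absorbed by the inverse different. *)
Lemma summand_coefM y f : summand_coef y -> ringint v f -> summand_coef (y * f).
Proof.
move=> [n [a [b [Aa Db ->]]]] int_f; exists n, a, (fun j => b j * f).
split=> // [j z int_z|].
  by rewrite -mulrA; apply: Db; apply: ringintM.
by rewrite mulr_suml; apply: eq_bigr => j _; rewrite mulrA.
Qed.

Lemma field_traceE (x : L) : (field_trace x)%:A = galTrace 1 {:L} x.
Proof.
have /vlineP[c Dc] := mem_galTrace (extension_galois char0 L) (memvf x).
by rewrite /field_trace Dc; apply: (descendK (in_alg L)).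
Qed.

Lemma field_trace_sum (I : Type) (r : seq I) (x : I -> L) :
  field_trace (\sum_(j <- r) x j) = \sum_(j <- r) field_trace (x j).
Proof.
apply: (fmorph_inj (in_alg L)); rewrite rmorph_sum /= field_traceE raddf_sum /=.
by apply: eq_bigr => j _; rewrite field_traceE.
Qed.

Lemma center_emb_integral y :
  summand_coef y -> center_emb (dL * y) \in intgalg_of hF.
Proof.
move=> [n [a [b [Aa Db ->]]]]; apply/intgalgP=> g.
have K0 := closure_char0 iota char0.
have d_neq0 : (ic_deg (chi i))%:R != 0 :> L.
  rewrite -(fmorph_eq0 (ic_emb (chi i))) rmorph_nat natr_neq0 //.
  by have /mx_irrP[] := ic_irr (chi i).
have G_neq0 : #|gT|%:R != 0 :> L.
  by rewrite -(fmorph_eq0 (ic_emb (chi i))) rmorph_nat group_order_neq0.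
have -> : center_emb (dL * \sum_j a j * b j) g
        = \sum_j field_trace (b j * (a j * ic_val (chi i) g^-1%g)).
  rewrite -field_trace_sum; apply: (fmorph_inj (in_alg L)).
  rewrite /= field_traceE (center_embE char0) -/L.
  have trZ (x : L) : galTrace 1 {:L} (dL * x) = dL * galTrace 1 {:L} x.
    rewrite /galTrace mulr_sumr; apply: eq_bigr => s _.
    by rewrite rmorphM fmorph_div !rmorph_nat.
  have cancel_dL : (ic_deg (chi i))%:R / #|gT|%:R * dL = 1.
    by rewrite /dL mulrA divfK // divff.
  rewrite -[dL * _ * _]mulrA trZ mulrA cancel_dL mul1r mulr_suml.
  congr (galTrace _ _ _); apply: eq_bigr => j _; rewrite mulrAC mulrC.
  by rewrite mulrA.
(* [Aa] makes [a j] times the character value integral, and [Db] then makes the trace integral. The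
   value is in the ideal through indicator coefficients. *)
apply: (@rpred_sum _ (valring_of hF)) => j _; apply: Db; apply: Aa.
exists (fun h => (h == g^-1%g)%:R : L) => [h|].
  by case: (h == _); [apply: ringint1 hF L | apply: ringint0 hF L].
rewrite (bigD1 g^-1%g) //= eqxx mul1r big1 ?addr0 // => h /negPf ->.
by rewrite mul0r.
Qed.

(** Both sides vanish under the other representations. The idempotent disappears from the powers
    because [center_emb] already lands in the component of [chi i]. *)
Lemma summand_star b (H : 'M[galg F gT]_b) (a : L) :
  let f := red_char_poly (chi i) (map_mx (fun a => a * idem (chi i)) H) in
  let m := (ic_deg (chi i) * b)%N in
  center_emb a *: star chi H
    = (-1) ^+ m.+1 *: \sum_(1 <= j < m.+1) center_emb (a * f`_j) *: H ^+ j.-1.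
Proof.
move=> f m; apply: map_rep_ext_inj => l.
rewrite !map_mxZ map_star rmorph_sign map_mx_sum.
have [-> | neq_li] := eqVneq l i; last first.
  rewrite /= (rep_ext_center_emb_neq char0 halg hchi) // scale0r.
  rewrite big1 ?scaler0 // => j _.
  by rewrite map_mxZ /= (rep_ext_center_emb_neq char0 halg hchi) // scale0r.
rewrite (map_star_component char0 halg) -/f -/m /= rep_ext_center_emb // scalerA.
rewrite commr_sign -scalerA scaler_sumr; congr (_ *: _).
apply: eq_bigr => j _; rewrite map_mxZ /= rep_ext_center_emb // scalerA rmorphXn.
by rewrite rmorphM /= scalar_mxM.
Qed.

Lemma char_summand_scriptH x : char_summand v (chi i) x -> scriptH v chi x.
Proof.
move=> [y sum_y ->]; rewrite -/dL; split; first split.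
- exact: center_emb_integral.
(* Under each representation the element acts as a scalar, hence commutes with everything. *)
- move=> z _; apply: (rep_ext_inj char0 hchi) => l; rewrite !rmorphM /=.
  have [-> | neq_li] := eqVneq l i.
    by rewrite rep_ext_center_emb // -!mulmxE scalar_mxC.
  by rewrite (rep_ext_center_emb_neq char0 halg hchi) // mul0r mulr0.
move=> b H intH; rewrite summand_star.
apply: (@mxOverZ _ _ _ (intgalg_of hF)); first by apply: rpred_sign.
apply: rpred_sum => j _.
apply: (@mxOverZ _ _ _ (intgalg_of hF)); last exact: mxOver_pow.
rewrite -mulrA; apply: center_emb_integral; apply: summand_coefM => //.
by rewrite (red_char_poly_idem char0 halg); apply: ringint_red_char_poly.
Qed.

End CharSummand.

Lemma trace_der_star b (H : 'M[galg F gT]_b) :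
  trace_der F gT *: star chi H = trace_der F gT *: \adj H.
Proof.
apply: map_rep_ext_inj => i; rewrite !map_mxZ map_star /=.
have [d1 | d_neq1] := eqVneq (ic_deg (chi i)) 1%N.
  by rewrite (star_component_linear char0 halg).
by rewrite trace_der_rep_ext // !scale0r.
Qed.

Lemma trace_der_integral : trace_der F gT \in intgalg_of hF.
Proof.
apply/intgalgP=> g; rewrite ffunE.
exact: (rpred_nat (valring_of hF)).
Qed.

Lemma der_summand_scriptH x : der_summand v x -> scriptH v chi x.
Proof.
move=> [a int_a ->]; split; first split.
- exact: (rpredM (int_a : a \in intgalg_of hF) trace_der_integral).
- move=> y _; apply: (rep_ext_inj char0 hchi) => i; rewrite !rmorphM /=.
  have [d1 | d_neq1] := eqVneq (ic_deg (chi i)) 1%N.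
    by rewrite -!mulmxE [rep_ext _ y](mx1_trace _ d1) scalar_mxC.
  by rewrite trace_der_rep_ext // !(mulr0, mul0r).
move=> b H intH; rewrite -scalerA trace_der_star.
apply: (@mxOverZ _ _ _ (intgalg_of hF)) => //.
apply: (@mxOverZ _ _ _ (intgalg_of hF)); first exact: trace_der_integral.
exact: mxOver_adj.
Qed.

Lemma scriptHD x y :
  scriptH v chi x -> scriptH v chi y -> scriptH v chi (x + y).
Proof.
move=> [[int_x cent_x] Hx] [[int_y cent_y] Hy]; split; first split.
- exact: (rpredD (int_x : x \in intgalg_of hF) int_y).
- by move=> z int_z; rewrite mulrDl mulrDr cent_x ?cent_y.
move=> b H intH; rewrite scalerDl.
suff : x *: star chi H + y *: star chi H \is a mxOver (intgalg_of hF) by [].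
by apply: rpredD; [apply: Hx | apply: Hy].
Qed.

Lemma scriptH0 : scriptH v chi 0.
Proof.
split; first split=> [|y _]; first exact: (rpred0 (intgalg_of hF)).
  by rewrite mul0r mulr0.
move=> b H _; rewrite scale0r; apply: mxOver0.
exact: (rpred0 (intgalg_of hF)).
Qed.

Lemma char_summand_rep_ext_neq i l x :
  l != i -> char_summand v (chi i) x -> rep_ext (chi l) x = 0.
Proof.
by move=> neq_li [y _ ->]; rewrite (rep_ext_center_emb_neq char0 halg hchi).
Qed.

(** Each representation sees a single summand: [t] if its character is linear, otherwise the [z i]
    of its own index, since [trace_der] is killed. *)
Lemma summand_direct t z (P := fun i => ic_deg (chi i) != 1%N) :
    der_summand v t -> (forall i, P i -> char_summand v (chi i) (z i)) ->
    t + \sum_(i | P i) z i = 0 ->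
  t = 0 /\ (forall i, P i -> z i = 0).
Proof.
move=> [a _ ->] Pz sum0; set t' := a * _ in sum0 *.
have t0 : t' = 0.
  apply: (rep_ext_inj char0 hchi) => l; rewrite rmorph0.
  have [d1 | d_neq1] := eqVneq (ic_deg (chi l)) 1%N; last first.
    by rewrite rmorphM /= trace_der_rep_ext // mulr0.
  have := congr1 (rep_ext (chi l)) sum0.
  rewrite rmorphD rmorph_sum rmorph0 /= big1 ?addr0 // => i Pi.
  apply: char_summand_rep_ext_neq (Pz i Pi).
  by apply: contraTneq Pi => <-; rewrite /P d1.
split=> // i Pi; apply: (rep_ext_inj char0 hchi) => l; rewrite rmorph0.
have [-> | neq_li] := eqVneq l i; last first.
  exact: char_summand_rep_ext_neq (Pz i Pi).
have := congr1 (rep_ext (chi i)) sum0.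
rewrite t0 add0r rmorph_sum rmorph0 (bigD1 i) //=.
rewrite big1 ?addr0 // => j /andP[Pj neq_ji].
by apply: char_summand_rep_ext_neq (Pz j Pj); rewrite eq_sym.
Qed.

End Containment.

(* The first conjunct is the directness of the sum, the second one is the
   containment. *)
Theorem corollary6p21 (F : fieldType) (v : F -> int) (hF : local_field v)
    (char0 : [pchar F] =i pred0) (p : nat) (hp : residue_char v p)
    (Fbar : closedFieldType) (iota : {rmorphism F -> Fbar})
    (halg : forall x : Fbar, algebraicOver iota x)
    (gT : finGroupType) (k : nat) (chi : 'I_k -> irrchar iota gT)
    (hchi : galois_representatives chi) :
  (forall (t : galg F gT) (z : 'I_k -> galg F gT),
     der_summand v t ->
     (forall i, ic_deg (chi i) != 1%N -> char_summand v (chi i) (z i)) ->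
     t + \sum_(i | ic_deg (chi i) != 1%N) z i = 0 ->
     t = 0 /\ (forall i, ic_deg (chi i) != 1%N -> z i = 0)) /\
  (forall (t : galg F gT) (z : 'I_k -> galg F gT),
     der_summand v t ->
     (forall i, ic_deg (chi i) != 1%N -> char_summand v (chi i) (z i)) ->
     scriptH v chi (t + \sum_(i | ic_deg (chi i) != 1%N) z i)).
Proof.
split=> t z der_t char_z.
  exact: (summand_direct char0 halg hchi der_t char_z).
apply: (scriptHD hF); first exact: (der_summand_scriptH hF char0 halg hchi).
apply: big_ind => [|x y|i nlin_i]; first exact: (scriptH0 hF).
  exact: (scriptHD hF).
exact: (char_summand_scriptH hF char0 halg hchi (char_z i nlin_i)).
Qed.
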